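(* Let $\mathbb{F}$ be a field with $\operatorname{char}\mathbb{F}=0$, let $n\ge2$ be an integer, and let $(L,\mu)$ be an admissible pair over $\mathbb{F}$, with $L=\prod_{j\ge-1}L_j$ and $\mu\in L_{n-1}$. Then $L=\bigoplus_{j=-1}^{n-1}L_j$, where $L_{n-1}=\mathbb{F}\mu$, the subspace $S:=\bigoplus_{j=-1}^{n-2}L_j$ is an ideal in $L$, and $L_j=(\operatorname{ad}L_{-1})^{n-j-1}\mu$ for $j=0,\ldots,n-1$.
   Context: A pair $(L,\mu)$, where $L=\prod_{j\ge-1}L_j$ is a $\mathbb{Z}$-graded Lie superalgebra and $\mu\in L_{n-1}$, is called admissible if the following hold: (L1) $L$ is transitive: if $a\in L_j$ with $j\ge0$ and $[a,L_{-1}]=0$, then $a=0$; (L2) $L$ is generated by $L_{-1}$ and $\mu$; (L3) $[\mu,L_0]=0$. $(\operatorname{ad}L_{-1})^{k}\mu$ denotes the span of all elements $(\operatorname{ad}a_1)\cdots(\operatorname{ad}a_k)\mu$ with $a_1,\ldots,a_k\in L_{-1}$ (and $\mathbb{F}\mu$ for $k=0$). *)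

(* Defs.v *)
From mathcomp Require Import all_boot all_order all_algebra.
From mathcomp Require Import boolp classical_sets.

Set Implicit Arguments.
Unset Strict Implicit.
Unset Printing Implicit Defensive.

Import GRing.Theory.
Local Open Scope classical_set_scope.
Local Open Scope ring_scope.

Section LinearAlgebra.
Variables (F : fieldType) (V : lmodType F).
Implicit Types (A W : set V).

Definition subspace A : Prop :=
  A 0 /\ forall (a : F) (x y : V), A x -> A y -> A (a *: x + y).

Definition lspan A : set V := smallest subspace A.

Definition direct_sum (m : nat) (U : 'I_m -> set V) (W : set V) : Prop :=
  W = [set x | exists2 u : {ffun 'I_m -> V},
                 (forall i, U i (u i)) & x = \sum_i u i] /\
  (forall u : {ffun 'I_m -> V},
     (forall i, U i (u i)) -> \sum_i u i = 0 -> forall i, u i = 0).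

End LinearAlgebra.

(* The parity is a bool: [false] is even, [true] is odd, and parities add by
   [addb]. *)
Structure lieSuperalgebra (F : fieldType) := LieSuperalgebra {
  carrier :> lmodType F;
  parity_part : bool -> set carrier;
  bracket : carrier -> carrier -> carrier;
  parity_subspace : forall p, subspace (parity_part p);
  parity_sum : forall x, exists2 x0, parity_part false x0 &
                         exists2 x1, parity_part true x1 & x = x0 + x1;
  parity_cap : forall x, parity_part false x -> parity_part true x -> x = 0;
  bracket_linearl : forall (a : F) x y z,
    bracket (a *: x + y) z = a *: bracket x z + bracket y z;
  bracket_linearr : forall (a : F) x y z,
    bracket z (a *: x + y) = a *: bracket z x + bracket z y;
  bracket_parity : forall p q x y, parity_part p x -> parity_part q y ->
    parity_part (p (+) q) (bracket x y);
  bracket_skew : forall p q x y, parity_part p x -> parity_part q y ->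
    bracket x y = - ((-1) ^+ (p && q) *: bracket y x);
  bracket_jacobi : forall p q x y z, parity_part p x -> parity_part q y ->
    bracket x (bracket y z) =
      bracket (bracket x y) z + (-1) ^+ (p && q) *: bracket y (bracket x z)
}.

Arguments parity_part {F} _ _.
Arguments bracket {F _} _ _.

(* A Z-graded Lie superalgebra L = \prod_(j >= -1) L_j.  The component L_j is
   the image of the idempotent [proj j]; [proj_prod] says that
   x |-> (proj j x)_j identifies L with the full product of the L_j, and
   [proj_bracket] is the formula for the bracket of two elements of the
   product, [x, y]_k = \sum_(i + j = k) [x_i, y_j], where k = m - 2 and
   i, j >= -1, so that the sum is finite.  On homogeneous elements it says
   [L_i, L_j] \subset L_(i + j); for k < -2 there is nothing to require. *)
Structure gradedLieSuperalgebra (F : fieldType) := GradedLieSuperalgebra {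
  lie_of :> lieSuperalgebra F;
  proj : int -> {linear lie_of -> lie_of};
  projK : forall i j x, proj i (proj j x) = if i == j then proj j x else 0;
  proj_lt : forall j x, j < -1 -> proj j x = 0;
  proj_prod : forall u : int -> lie_of, (forall j, proj j (u j) = u j) ->
    exists! x, forall j, proj j x = u j;
  proj_parity : forall j p x,
    parity_part lie_of p x -> parity_part lie_of p (proj j x);
  proj_bracket : forall (m : nat) x y,
    proj (m%:Z - 2) (bracket x y) =
      \sum_(i < m.+1) bracket (proj (i%:Z - 1) x) (proj (m%:Z - i%:Z - 1) y)
}.

Arguments proj {F} _ _.

Definition component (F : fieldType) (L : gradedLieSuperalgebra F) (j : int) :
  set L := [set x | proj L j x = x].

Arguments component {F} L j.

Section SubalgebrasAndIdeals.
Variables (F : fieldType) (L : lieSuperalgebra F).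
Implicit Types A I : set L.

(* Stability under taking parity components is not required here: the
   subalgebra generated by parity-homogeneous elements has it anyway, and
   requiring it would put the parity components of an inhomogeneous generator
   in the subalgebra that it generates. *)
Definition subalgebra A : Prop :=
  subspace A /\ forall x y, A x -> A y -> A (bracket x y).

Definition generated A : set L := smallest subalgebra A.

Definition ideal I : Prop :=
  [/\ subspace I,
      forall x0 x1, parity_part L false x0 -> parity_part L true x1 ->
        I (x0 + x1) -> I x0 /\ I x1
    & forall x y, I y -> I (bracket x y) /\ I (bracket y x)].

End SubalgebrasAndIdeals.

Section Admissible.
Variables (F : fieldType) (L : gradedLieSuperalgebra F).

Definition transitive_grading : Prop :=
  forall (j : int) (a : L), 0 <= j -> component L j a ->
    (forall b, component L (-1) b -> bracket a b = 0) -> a = 0.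

Definition admissible (n : nat) (mu : L) : Prop :=
  [/\ component L (n%:Z - 1) mu,
      transitive_grading,
      generated (component L (-1) `|` [set mu]) = setT
    & forall a, component L 0 a -> bracket mu a = 0].

Definition ad_pow (k : nat) (mu : L) : set L :=
  lspan [set foldr bracket mu (val a) |
           a in [set a : k.-tuple L | forall i, component L (-1) (tnth a i)]].

End Admissible.

(* Main.v *)
Require Import Defs.
From HB Require Import structures.
From mathcomp Require Import all_boot all_order all_algebra.
From mathcomp Require Import boolp classical_sets.
From mathcomp Require Import zify.

Import GRing.Theory.
Local Open Scope classical_set_scope.
Local Open Scope ring_scope.

(** The theorem says that brackets of iterated brackets
    (ad a_1) .. (ad a_t) mu, with all a_i in L_{-1}, produce nothing new.  Once
    [mu, (ad a_1) .. (ad a_t) mu] = 0 is known for t <= n - 1, the Jacobi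
    identity gives by induction that such elements of degrees i and j >= 0
    bracket into the span of those of degree i + j, and to zero if
    i + j >= n - 1 ([bracket_monomials]).  Hence L_{-1}, the spans of iterated
    brackets and the line of mu form a subalgebra ([proj_piece]); it contains
    the generators, so it is L.  As no bracket reaches degree n - 1, the lower
    components form an ideal.

    The vanishing for t = n - 1 is the axiom [mu, L_0] = 0.  For t < n - 1
    transitivity reduces it to
      (ad b_1) .. (ad b_k) [mu, (ad a_1) .. (ad a_t) mu] = 0, k = 2n - 1 - t,
    an identity in 2n - 1 vectors of L_{-1}.  These supercommute, because
    L_{-2} = 0, and the Leibniz rule expands the left-hand side into terms
    phi(S), indexed by subsets S of the family: the vectors of S act on the
    first mu and the others on the second.  Since L has no component below
    degree -1, phi(S) = 0 unless S has n - 1 or n elements, and in these cases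
    one argument of the bracket lies in L_0 and the other one in L_{-1}.
    Applying vectors to [mu, L_0] = 0 = [L_0, mu] gives linear relations: the
    sums of phi over the subsets of a set of size n vanish, and so do the sums
    over the supersets of a set of size n - 1.  The identity asks that the sum
    of phi over the sets that avoid the a_i vanish.  With u and w the parts of
    this sum given by the sets of size n and n - 1, averaging the relations
    yields u = - (n - t) w and, by induction on t, w = - (n - t) u; hence
    ((n - t)^2 - 1) w = 0, and u = w = 0 in characteristic 0
    ([sum_subsets_eq0]). *)

Set Implicit Arguments.
Unset Strict Implicit.
Unset Printing Implicit Defensive.

(** * Sums over families of subsets *)

Section SubsetFamilies.
Local Open Scope set_scope.
Variables (X : finType).
Implicit Types S T K I Z : {set X}.

(** The sets counted here are S with one point of Z outside S adjoined. *)
Lemma card_succ_interval S Z : S \subset Z ->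
  #|[set K : {set X} | [&& S \subset K, K \subset Z & #|K| == #|S|.+1]]| =
    (#|Z| - #|S|)%N.
Proof.
move=> SZ; rewrite -(cardsDS SZ).
have -> : [set K : {set X} | [&& S \subset K, K \subset Z & #|K| == #|S|.+1]] =
          [set i |: S | i in Z :\: S].
  apply/setP => K; rewrite inE; apply/idP/imsetP.
    case/and3P=> SK KZ /eqP cK.
    have /cards1P[i Ki] : #|K :\: S| == 1%N by rewrite cardsDS // cK subSnn.
    have : i \in K :\: S by rewrite Ki set11.
    rewrite inE => /andP[iS iK]; exists i; first by rewrite inE iS (fintype.subsetP KZ).
    rewrite -Ki; apply/setP=> x; rewrite !inE; have := fintype.subsetP SK x.
    by case: (x \in S) => /= [->|_]; rewrite ?orbT ?orbF.
  case=> i; rewrite inE => /andP[iS iZ] ->.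
  by rewrite finset.subsetUr finset.subUset finset.sub1set iZ SZ cardsU1 iS /= add1n eqxx.
rewrite card_in_imset // => i j; rewrite !inE => /andP[iS _] /andP[jS _] E.
have : i \in j |: S by rewrite -E setU11.
by rewrite !inE (negPf iS) orbF => /eqP.
Qed.

Lemma subset_setC_card S T : (S \subset ~: T) = (#|S :&: T| == 0%N).
Proof. by rewrite cards_eq0 finset.setI_eq0 finset.disjoints_subset. Qed.

Lemma count_draws_off S T m :
  #|[set I : {set X} | (I \subset ~: T) && (#|I| == m) && (I \subset S)]| =
    'C(#|S| - #|S :&: T|, m).
Proof.
rewrite -cardsD -cards_draws; apply: eq_card => I; rewrite !inE.
by rewrite finset.setDE finset.subsetI; do !case: (_ \subset _); case: (_ == _).
Qed.

Lemma count_deletions_off S T :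
  #|[set a | (a \in T) && (S \subset ~: (T :\ a))]| =
    (if #|S :&: T| == 0 then #|T| else #|S :&: T| == 1)%N.
Proof.
case: eqP => [/cards0_eq ST0 | ].
  apply: eq_card => a; rewrite !inE subset_setC_card cards_eq0.
  by rewrite finset.setIDA ST0 finset.set0D eqxx andbT.
move=> /eqP ST; case: eqP => [/eqP /cards1P[b STb] | ST1].
  rewrite -[RHS]/1%N -(cards1 b); apply: eq_card => a; rewrite !inE subset_setC_card cards_eq0.
  rewrite finset.setIDA STb.
  have : b \in S :&: T by rewrite STb set11.
  rewrite inE => /andP[_ bT].
  have [->|ne] := eqVneq a b; first by rewrite bT finset.setDv eqxx.
  apply/negP => /andP[_ /eqP /setP /(_ b)]; rewrite !inE eqxx andbT eq_sym => h.
  by rewrite h in ne.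
rewrite -[RHS]/0%N; apply/eqP; rewrite cards_eq0; apply/eqP/setP => a.
rewrite !inE; apply/negP => /andP[aT].
rewrite subset_setC_card finset.setIDA => /eqP h.
have := cardsD1 a (S :&: T); rewrite h.
by case: (a \in _) => /= h'; [apply: ST1|move: ST; rewrite h'].
Qed.

Lemma sum_count (V : zmodType) (J : finType) (P : pred J) (Q : J -> pred {set X})
    (R : pred {set X}) (phi : {set X} -> V) :
  (forall j S, P j -> Q j S -> R S) ->
  \sum_(j | P j) \sum_(S | Q j S) phi S =
    \sum_(S | R S) phi S *+ #|[set j | P j && Q j S]|.
Proof.
move=> h; rewrite (exchange_big_dep R) //=; apply: eq_bigr => S _.
by rewrite sumr_const; congr (_ *+ _); apply: eq_card => j; rewrite !inE.
Qed.
End SubsetFamilies.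

(** In the application [phi S] is, up to sign, the bracket of the vectors of S
    applied to one element with the remaining vectors applied to another one.
    In degrees below -1 there is nothing left, so that only two consecutive
    sizes of S survive.  The hypotheses on [phi] then say that elements of
    degree 0 centralise both elements. *)
Section Vanishing.
Local Open Scope set_scope.
Variables (F : fieldType) (charF : [pchar F] =i pred0) (V : lmodType F).
Variables (X : finType) (n : nat) (phi : {set X} -> V).
Implicit Types S T K I : {set X}.
Hypotheses (cardX : (#|X| = n + n.-1)%N) (n_gt0 : (0 < n)%N).
Hypothesis phi_supp : forall S, #|S| != n -> #|S| != n.-1 -> phi S = 0.
Hypothesis phi_sub : forall K, #|K| = n -> \sum_(S : {set X} | S \subset K) phi S = 0.
Hypothesis phi_sup : forall I, #|I| = n.-1 -> \sum_(S : {set X} | I \subset S) phi S = 0.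

Let sum_off m T := \sum_(S : {set X} | (S \subset ~: T) && (#|S| == m)) phi S.

Lemma sum_sub_split (P : pred {set X}) (w : {set X} -> nat) :
  \sum_(S | P S) phi S *+ w S =
    \sum_(S | P S && (#|S| == n)) phi S *+ w S +
    \sum_(S | P S && (#|S| == n.-1)) phi S *+ w S.
Proof.
rewrite (bigID (fun S => #|S| == n)) /=; congr (_ + _).
rewrite (bigID (fun S => #|S| == n.-1)) /= [X in _ + X]big1 ?addr0.
  apply: eq_bigl => S; case: (P S) => //=.
  by apply/andb_idl => /eqP ->; lia.
by move=> S /andP[/andP[_ h1] h2]; rewrite phi_supp ?mul0rn.
Qed.

(** The vanishing of the sums below K, summed over all K of size n that avoid
    T: a set of size n - 1 avoiding T lies in n - #|T| such K. *)
Lemma sum_off_sub T : (#|T| < n)%N ->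
  sum_off n T = - (sum_off n.-1 T *+ (n - #|T|)).
Proof.
move=> Tn; apply/eqP; rewrite -addr_eq0; apply/eqP.
have cT : (#|~: T| = n + n.-1 - #|T|)%N by rewrite -cardX cardsCs finset.setCK.
transitivity (\sum_(K : {set X} | (K \subset ~: T) && (#|K| == n))
                \sum_(S : {set X} | S \subset K) phi S); last first.
  by apply: big1 => K /andP[_ /eqP /phi_sub].
rewrite (sum_count _ (R := fun S => S \subset ~: T)); last first.
  by move=> K S /andP[KT _] SK; apply: fintype.subset_trans KT.
rewrite sum_sub_split; congr (_ + _).
  apply: eq_bigr => S /andP[ST /eqP cS].
  rewrite (_ : finset _ = [set S]) ?cards1 //; apply/setP => K; rewrite !inE.
  apply/idP/eqP => [/andP[/andP[_ /eqP cK] SK]| ->]; last by rewrite ST cS eqxx /=.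
  by apply/esym/eqP; rewrite eqEcard SK cK cS leqnn.
rewrite /sum_off -sumrMnl; apply: eq_bigr => S /andP[ST /eqP cS]; congr (_ *+ _).
transitivity (#|~: T| - #|S|)%N; first by rewrite cT cS; lia.
rewrite -card_succ_interval //; apply: eq_card => K; rewrite !inE cS prednK //.
by rewrite andbC.
Qed.

(** The vanishing of the sums above I, summed over all I of size n - 1 that
    avoid T.  A set S of size n contains such an I in n ways if it avoids T, in
    one way if it meets T in a point, and in no way otherwise.  In the middle
    term S is counted #|T|, 1 or 0 times, so the difference is supported on
    the S that avoid T. *)
Lemma sum_off_sup T : (#|T| < n)%N ->
  sum_off n.-1 T + \sum_(a in T) sum_off n (T :\ a) + sum_off n T *+ (n - #|T|) = 0.
Proof.
move=> Tn.
transitivity (\sum_(I : {set X} | (I \subset ~: T) && (#|I| == n.-1))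
                \sum_(S : {set X} | I \subset S) phi S); last first.
  by apply: big1 => K /andP[_ /eqP /phi_sup].
rewrite [RHS](sum_count _ (R := predT)) // [RHS]sum_sub_split /sum_off /=.
rewrite [X in _ + X + _ = _](sum_count _ (R := fun S => #|S| == n)); last first.
  by move=> a S _ /andP[].
rewrite -addrA [RHS]addrC; congr (_ + _).
  rewrite (eq_bigl (fun S => (#|S| == n.-1) && (S \subset ~: T)));
    last by move=> S; rewrite andbC.
  rewrite big_mkcondr /=; apply: eq_bigr => S /eqP cS.
  rewrite -mulrb count_draws_off subset_setC_card cS; congr (_ *+ _).
  case: (posnP #|S :&: T|) => [->|h]; first by rewrite subn0 binn.
  have le := subset_leq_card (finset.subsetIl S T).
  by rewrite bin_small //; lia.
rewrite [X in X *+ (_ - _)](eq_bigl (fun S => (#|S| == n) && (S \subset ~: T)));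
  last by move=> S; rewrite andbC.
rewrite big_mkcondr /= -sumrMnl -big_split /=; apply: eq_bigr => S /eqP cS.
rewrite -mulrb -mulrnA -mulrnDr; congr (_ *+ _).
under eq_finset do rewrite cS eqxx andbT.
rewrite count_draws_off count_deletions_off cS subset_setC_card.
case: (posnP #|S :&: T|) => [->|h].
  by rewrite subn0 mul1n -[in RHS](prednK n_gt0) binSn prednK //; lia.
case: eqP => [c1|ne1]; first by rewrite c1 /= mul0n addn0 subn1 binn.
have le := subset_leq_card (finset.subsetIl S T).
by rewrite bin_small //; lia.
Qed.

(** Eliminating u leaves (m ^ 2 - 1) w = 0; this is where the characteristic
    is used. *)
Lemma eq_neg_mul_sq (u w : V) m : (1 < m)%N ->
  u = - (w *+ m) -> w + u *+ m = 0 -> u = 0.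
Proof.
move=> m_gt1 ->; rewrite mulNrn -mulrnA => h.
have mm : (m * m = (m * m).-1.+1)%N by rewrite prednK //; nia.
suff : ((m * m).-1%:R : F) *: w == 0.
  rewrite scaler_eq0 => /orP[|/eqP ->]; last by rewrite mul0rn oppr0.
  by rewrite (GRing.pcharf0P F).1 //; case: m m_gt1 {h mm} => [|[|m]].
by rewrite scaler_nat -oppr_eq0 -h mm mulrSr opprD addrA addrAC subrr add0r.
Qed.

(** Induction on T: once the middle term of [sum_off_sup] vanishes, the two
    relations between the sums over sizes n - 1 and n are independent, because
    their coefficient n - #|T| is at least 2. *)
Lemma sum_off_eq0 T : (#|T| < n.-1)%N -> sum_off n T = 0.
Proof.
elim: #|T| {-2}T (erefl #|T|) => {T} [|t IHt] T cT lt_T.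
  have sup := sum_off_sup (T := T); have := sum_off_sub (T := T).
  rewrite cT in sup *; have T0 := cards0_eq cT.
  move: (sup n_gt0) => /eqP; rewrite T0 big_set0 addr0 -T0 => /eqP {}sup sub.
  apply: eq_neg_mul_sq (sub n_gt0) sup; lia.
have Tn : (#|T| < n)%N by lia.
have := sum_off_sup Tn; rewrite big1 ?addr0; last first.
  move=> a aT; have cTa : #|T :\ a| = t by move: cT; rewrite (cardsD1 a) aT => -[].
  by apply: IHt; rewrite cTa //; lia.
by move=> sup; apply: eq_neg_mul_sq (sum_off_sub Tn) sup; lia.
Qed.

Lemma sum_subsets_eq0 K : (n <= #|K|)%N -> \sum_(S : {set X} | S \subset K) phi S = 0.
Proof.
move=> leK; set T := ~: K.
have cT : (#|T| = n + n.-1 - #|K|)%N by rewrite -cardX cardsCs finset.setCK.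
have [ltT|geT] := ltnP #|T| n.-1; last first.
  have := max_card K; rewrite cardX => le_K.
  by apply: phi_sub; lia.
have u0 := sum_off_eq0 ltT.
have Tn : (#|T| < n)%N by lia.
have := sum_off_sup Tn; rewrite u0 mul0rn addr0 big1 ?addr0 => [w0|a aT]; last first.
  by apply: sum_off_eq0; apply: leq_ltn_trans ltT; apply/subset_leq_card/finset.subsetDl.
rewrite (eq_bigr (fun S => phi S *+ 1)); last by move=> S _; rewrite mulr1n.
rewrite (sum_sub_split _ (fun=> 1%N)).
by move: u0 w0; rewrite /sum_off finset.setCK => -> ->; rewrite addr0.
Qed.
End Vanishing.

(** * Iterated brackets and shuffles *)

Section BracketLinearity.
Variables (F : fieldType) (L : lieSuperalgebra F).
Implicit Types x y z : L.

HB.instance Definition _ x := GRing.isLinear.Build F L L _ (bracket x)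
  (fun a y z => bracket_linearr a y z x).

Lemma bracketDl x y z : bracket (x + y) z = bracket x z + bracket y z.
Proof. by have := bracket_linearl 1 x y z; rewrite !scale1r. Qed.

Lemma bracket0l z : bracket 0 z = 0 :> L.
Proof. by apply: (addrI (bracket 0 z)); rewrite -bracketDl !addr0. Qed.

Lemma bracketZl a x z : bracket (a *: x) z = a *: bracket x z.
Proof. by rewrite -[a *: x]addr0 bracket_linearl bracket0l addr0. Qed.

Lemma bracket_eq0_skew p q x y : parity_part L p x -> parity_part L q y ->
  bracket x y = 0 -> bracket y x = 0.
Proof. by move=> px qy h; rewrite (bracket_skew qy px) h scaler0 oppr0. Qed.

End BracketLinearity.

Section IteratedBrackets.
Variables (F : fieldType) (L : lieSuperalgebra F) (X : Type).
Variables (e : X -> L) (p : X -> bool).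
Hypothesis e_parity : forall i, parity_part L (p i) (e i).
Hypothesis e_comm : forall i j, bracket (e i) (e j) = 0.
Implicit Types (r : seq X) (x y z : L).

(** The head of the list acts first.  This is the order in which [shuffle]
    distributes the vectors over the two arguments of a bracket. *)
Definition ad_seq r y := foldl (fun x i => bracket (e i) x) y r.

Definition par_seq r := foldr (fun i b => p i (+) b) false r.

Lemma ad_seq_is_linear r : linear (ad_seq r).
Proof.
elim: r => [|i r IH] a x y //=; rewrite /ad_seq /= -/(ad_seq _ _).
by rewrite linearP -[LHS]/(ad_seq r _) IH.
Qed.
HB.instance Definition _ r := GRing.isLinear.Build F L L _ (ad_seq r) (ad_seq_is_linear r).

Lemma ad_seq_parity q r y : parity_part L q y ->
  parity_part L (par_seq r (+) q) (ad_seq r y).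
Proof.
elim: r q y => [|i r IH] q y qy //=.
rewrite (addbC (p i)) -addbA; apply: IH.
by apply: bracket_parity.
Qed.

Lemma bracket_ad_seqC i r y :
  bracket (e i) (ad_seq r y) = (-1) ^+ (p i && par_seq r) *: ad_seq r (bracket (e i) y).
Proof.
elim: r y => [|j r IH] y /=; first by rewrite andbF scale1r.
rewrite IH (bracket_jacobi _ (e_parity i) (e_parity j)) e_comm bracket0l add0r.
rewrite linearZ /= scalerA -signr_addb; congr ((-1) ^+ _ *: _).
by rewrite andb_addr addbC.
Qed.

(** The term of the Leibniz expansion of an iterated bracket on [y, z] in which
    the vectors indexed by S act on y, which has parity q, and the others act
    on z.  The sign is the one of moving the latter past what already stands in
    the first argument. *)
Fixpoint shuffle r (S : {pred X}) q y z : L :=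
  if r is i :: r' then
    if i \in S then shuffle r' S (p i (+) q) (bracket (e i) y) z
    else (-1) ^+ (p i && q) *: shuffle r' S q y (bracket (e i) z)
  else bracket y z.

Lemma shuffle_cons i r S q y z : shuffle (i :: r) S q y z =
  if i \in S then shuffle r S (p i (+) q) (bracket (e i) y) z
  else (-1) ^+ (p i && q) *: shuffle r S q y (bracket (e i) z).
Proof. by []. Qed.

End IteratedBrackets.

Arguments shuffle : simpl never.

Section Shuffles.
Local Open Scope set_scope.
Variables (F : fieldType) (L : lieSuperalgebra F) (X : finType).
Variables (e : X -> L) (p : X -> bool).
Hypothesis e_parity : forall i, parity_part L (p i) (e i).
Hypothesis e_comm : forall i j, bracket (e i) (e j) = 0.
Implicit Types (r : seq X) (x y z : L) (S I K A B : {set X}).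

(** With [sum_interval_free], the step that splits a sum over an interval of
    sets according to whether a new point i belongs to them. *)
Lemma sum_interval_in (V : zmodType) i A B (G : {set X} -> V) :
  i \notin A -> i \notin B ->
  \sum_(S : {set X} | (i |: A \subset S) && (S \subset i |: B)) G S =
  \sum_(S : {set X} | (A \subset S) && (S \subset B)) G (i |: S).
Proof.
move=> iA iB; rewrite (reindex_onto (fun S => i |: S) (fun S => S :\ i)) /=; last first.
  by move=> S; rewrite finset.subUset finset.sub1set -andbA => /andP[iS _]; apply: finset.setD1K.
apply: eq_bigl => S; apply/idP/idP.
  case/andP=> /andP[AS SB] /eqP E.
  have iS : i \notin S by rewrite -E !inE eqxx.
  by rewrite -(finset.setU1K iA) -(finset.setU1K iB) -E !finset.setSD.
case/andP=> AS SB.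
have iS : i \notin S by apply: contra iB; apply: (fintype.subsetP SB).
by rewrite !finset.setUS //= finset.setU1K.
Qed.

Lemma sum_interval_free (V : zmodType) i A B (G : {set X} -> V) :
  i \notin A -> i \notin B ->
  \sum_(S : {set X} | (A \subset S) && (S \subset i |: B)) G S =
  \sum_(S : {set X} | (A \subset S) && (S \subset B)) G (i |: S) +
  \sum_(S : {set X} | (A \subset S) && (S \subset B)) G S.
Proof.
move=> iA iB; rewrite (bigID (fun S : {set X} => i \in S)) /= -sum_interval_in //.
congr (_ + _); apply: eq_bigl => S.
  by rewrite finset.subUset finset.sub1set; case: (i \in S); rewrite ?andbT ?andbF.
by rewrite -andbA -finset.subsetD1 finset.setU1K.
Qed.

Lemma shuffle_setU1 r S i q y z : i \notin r ->
  shuffle e p r [in i |: S] q y z = shuffle e p r [in S] q y z.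
Proof.
elim: r q y z => [|j r IH] q y z //; rewrite inE negb_or => /andP[ij ir].
rewrite !shuffle_cons; by rewrite !inE eq_sym (negPf ij) /=; case: (j \in S); rewrite IH.
Qed.

Definition restr r (A : {set X}) := [set i in r | i \in A].

(** Leibniz rule, partially summed: the vectors of I act on y, those outside K
    act on z, and those in between are free; summing over the free ones
    reassembles the action on the bracket.  As the vectors supercommute, the
    fixed ones may be moved inside.  The parity q changes along the induction,
    so the way in which the sign depends on q has to be explicit; the rest s of
    the sign only has to be uniform in q, y and z. *)
Lemma sum_shuffle r I K : uniq r -> I \subset K ->
  exists s, forall q y z, parity_part L q y ->
  \sum_(S : {set X} | (restr r I \subset S) && (S \subset restr r K))
     shuffle e p r [in S] q y z =
  (-1) ^+ (s (+) (q && par_seq p [seq i <- r | i \notin K])) *: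
   ad_seq e [seq i <- r | i \in K :\: I]
     (bracket (ad_seq e [seq i <- r | i \in I] y)
              (ad_seq e [seq i <- r | i \notin K] z)).
Proof.
elim: r => [|i r IH] /=; [move=> _ _ | case/andP=> ir /IH{}IH /[dup] IK /IH[s {}IH]].
  exists false => q y z _; rewrite andbF scale1r /ad_seq /=.
  rewrite (big_pred1 finset.set0) // => S.
  have r0 A : restr [::] A = finset.set0 by apply/setP=> j; rewrite !inE.
  by rewrite !r0 finset.sub0set finset.subset0.
have nir A : i \notin restr r A by rewrite inE (negPf ir).
have rin A : i \in A -> restr (i :: r) A = i |: restr r A.
  by move=> iA; apply/setP=> j; rewrite !inE; case: eqVneq => // ->; rewrite iA.
have rout A : i \notin A -> restr (i :: r) A = restr r A.
  by move=> iA; apply/setP=> j; rewrite !inE; case: eqVneq => // ->; rewrite (negPf iA) !andbF.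
have shufU q y z S : shuffle e p (i :: r) [in i |: S] q y z =
    shuffle e p r [in S] (p i (+) q) (bracket (e i) y) z.
  by rewrite shuffle_cons setU11 shuffle_setU1.
have shufN q y z S : S \subset restr r K -> shuffle e p (i :: r) [in S] q y z =
    (-1) ^+ (p i && q) *: shuffle e p r [in S] q y (bracket (e i) z).
  move=> SK; rewrite shuffle_cons ifN //; apply: contra (nir K); exact: (fintype.subsetP SK).
rewrite finset.in_setD.
have [iI|iI] := boolP (i \in I).
  have iK := fintype.subsetP IK _ iI; rewrite iK /=.
  exists (s (+) (p i && par_seq p [seq i <- r | i \notin K])) => q y z qy.
  rewrite !rin // sum_interval_in //.
  under eq_bigr do rewrite shufU.
  rewrite IH; last exact: bracket_parity.
  congr ((-1) ^+ _ *: _); by rewrite andb_addl addbA.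
have [iK|iK] := boolP (i \in K) => /=.
  exists (s (+) (p i && par_seq p [seq i <- r | i \notin K]) (+)
            (p i && par_seq p [seq i <- r | i \in I])) => q y z qy.
  rewrite (rin K) // (rout I) // sum_interval_free //.
  under eq_bigr do rewrite shufU.
  under [X in _ + X]eq_bigr => S /andP[_ SK] do rewrite shufN //.
  rewrite -scaler_sumr !IH //; last exact: bracket_parity.
  rewrite (bracket_jacobi _ (e_parity i) (ad_seq_parity e_parity _ qy)).
  rewrite !(bracket_ad_seqC e_parity e_comm) bracketZl !linearZ /= linearD /= !linearZ /=.
  rewrite !scalerDr !scalerA -!signr_addb.
  congr ((-1) ^+ _ *: _ + (-1) ^+ _ *: _).
    move: (par_seq _ _) (par_seq _ _) => P Q; clear; by case: s (p i) q P Q => [] [] [] [] [].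
  move: (par_seq _ _) (par_seq _ _) => P Q; clear; by case: s (p i) q P Q => [] [] [] [] [].
exists s => q y z qy.
rewrite !rout //.
under eq_bigr => S /andP[_ SK] do rewrite shufN //.
rewrite -scaler_sumr IH // scalerA -signr_addb.
congr ((-1) ^+ _ *: _). by rewrite andb_addr addbCA (andbC q (p i)).
Qed.
End Shuffles.

(** For elements mu and nu that are killed by n + 1 vectors and centralise what
    n - 1 vectors make of the other one, the shuffles of 2n - 1 vectors satisfy
    the hypotheses of [sum_subsets_eq0]. *)
Section ShuffleVanishing.
Local Open Scope set_scope.
Variables (F : fieldType) (charF : [pchar F] =i pred0) (L : lieSuperalgebra F).
Variables (X : finType) (e : X -> L) (p : X -> bool).
Hypothesis e_parity : forall i, parity_part L (p i) (e i).
Hypothesis e_comm : forall i j, bracket (e i) (e j) = 0.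
Variables (r : seq X) (n : nat) (q : bool) (mu nu : L).
Hypotheses (r_uniq : uniq r) (r_full : forall i, i \in r).
Hypotheses (cardX : (#|X| = n + n.-1)%N) (n_gt0 : (0 < n)%N).
Hypothesis mu_parity : parity_part L q mu.
Hypothesis ad_mu_eq0 : forall s, (n < size s)%N -> ad_seq e s mu = 0.
Hypothesis ad_nu_eq0 : forall s, (n < size s)%N -> ad_seq e s nu = 0.
Hypothesis mu_ad_nu : forall s, size s = n.-1 -> bracket mu (ad_seq e s nu) = 0.
Hypothesis ad_mu_nu : forall s, size s = n.-1 -> bracket (ad_seq e s mu) nu = 0.

Let phi (S : {set X}) := shuffle e p r [in S] q mu nu.

Lemma size_filter_card (A : {set X}) : size [seq i <- r | i \in A] = #|A|.
Proof.
rewrite cardE; apply/perm_size/uniq_perm; [exact: filter_uniq|exact: enum_uniq|].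
by move=> i; rewrite mem_filter mem_enum r_full andbT.
Qed.

Lemma sum_interval_phi (I K : {set X}) : I \subset K -> exists s : bool,
  \sum_(S : {set X} | (I \subset S) && (S \subset K)) phi S =
  (-1) ^+ s *: ad_seq e [seq i <- r | i \in K :\: I]
     (bracket (ad_seq e [seq i <- r | i \in I] mu)
              (ad_seq e [seq i <- r | i \notin K] nu)).
Proof.
move=> IK; have [s h] := sum_shuffle e_parity e_comm r_uniq IK.
have rA (A : {set X}) : restr r A = A by apply/setP=> i; rewrite !inE r_full.
by move: (h q mu nu mu_parity); rewrite !rA => ->; eexists.
Qed.

Lemma ad_bracket_eq0 (K0 : {set X}) : (n <= #|K0|)%N ->
  ad_seq e [seq i <- r | i \in K0]
    (bracket mu (ad_seq e [seq i <- r | i \notin K0] nu)) = 0.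
Proof.
have sizeC (A : {set X}) : size [seq i <- r | i \notin A] = (n + n.-1 - #|A|)%N.
  rewrite -cardX -{2}[A]finset.setCK -cardsCs -size_filter_card; congr size; apply: eq_filter => i.
  by rewrite !inE.
have filter0 : [seq i <- r | i \in @finset.set0 X] = [::].
  by under eq_filter do rewrite inE; rewrite filter_pred0.
have sumK (K : {set X}) : exists s : bool,
    \sum_(S : {set X} | S \subset K) phi S =
    (-1) ^+ s *: ad_seq e [seq i <- r | i \in K]
      (bracket mu (ad_seq e [seq i <- r | i \notin K] nu)).
  have [s h] := sum_interval_phi (finset.sub0set K); exists s.
  rewrite (eq_bigl (fun S : {set X} => (finset.set0 \subset S) && (S \subset K))) => [|S].
    by rewrite h finset.setD0 filter0.
  by rewrite finset.sub0set.
move=> nK; have [s h] := sumK K0.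
have {h} : (-1) ^+ s *: ad_seq e [seq i <- r | i \in K0]
      (bracket mu (ad_seq e [seq i <- r | i \notin K0] nu)) = 0.
  rewrite -h; apply: (sum_subsets_eq0 charF cardX n_gt0) nK => {h} [S Sn Sn1|K cK|I cI].
  - have [s' h] := sum_interval_phi (fintype.subxx S).
    transitivity (\sum_(T : {set X} | (S \subset T) && (T \subset S)) phi T).
      rewrite (big_pred1 S) // => T; rewrite /= eq_sym finset.eqEsubset andbC //.
    rewrite h {h}; case: (ltnP n #|S|) => cS.
      by rewrite ad_mu_eq0 ?size_filter_card // bracket0l !linear0.
    by rewrite ad_nu_eq0 ?sizeC ?linear0 ?linear0 ?scaler0 //; lia.
  - have [s' ->] := sumK K.
    by rewrite mu_ad_nu ?linear0 ?scaler0 // sizeC cK; lia.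
  - have [s' h] := sum_interval_phi (finset.subsetT I).
    rewrite (eq_bigl (fun S : {set X} => (I \subset S) && (S \subset finset.setT)))
      => [|S]; last by rewrite finset.subsetT andbT.
    rewrite h; have -> : [seq i <- r | i \notin finset.setT] = [::].
      by under eq_filter do rewrite inE; rewrite filter_pred0.
    by rewrite -[ad_seq e [::] nu]/nu ad_mu_nu ?linear0 ?scaler0 // size_filter_card.
by move=> /eqP; rewrite scaler_eq0 signr_eq0 => /eqP.
Qed.

End ShuffleVanishing.

(** * Spans, parity and the grading *)

Section Spans.
Variables (F : fieldType) (V : lmodType F).
Implicit Types (A W : set V).

Lemma lspan_subspace A : subspace (lspan A).
Proof.
split=> [W [[W0 _] _] // | a x y Ax Ay W [sW AW]].
by apply: (sW.2 a); [apply: Ax|apply: Ay].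
Qed.

Lemma lspan_incl A x : A x -> lspan A x.
Proof. by move=> Ax W [_]; apply. Qed.

Lemma lspan_min A W : subspace W -> A `<=` W -> lspan A `<=` W.
Proof. by move=> sW AW x; apply. Qed.

Variables (W : set V) (subW : subspace W).

Lemma subspace0 : W 0. Proof. by case: subW. Qed.

Lemma subspaceD x y : W x -> W y -> W (x + y).
Proof. by move=> Wx Wy; rewrite -[x]scale1r; apply: subW.2. Qed.

Lemma subspaceZ a x : W x -> W (a *: x).
Proof. by move=> Wx; rewrite -[_ *: _]addr0; apply: subW.2 => //; apply: subspace0. Qed.

Lemma subspaceN x : W x -> W (- x).
Proof. by move=> Wx; rewrite -scaleN1r; apply: subspaceZ. Qed.

Lemma subspace_sum (I : Type) (s : seq I) (P : pred I) (f : I -> V) :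
  (forall i, P i -> W (f i)) -> W (\sum_(i <- s | P i) f i).
Proof. by move=> h; apply: big_ind => //; [apply: subspace0 | apply: subspaceD]. Qed.

End Spans.

Lemma bracket_lspan (F : fieldType) (L : lieSuperalgebra F) (A B W : set L) :
  subspace W -> (forall x y, A x -> B y -> W (bracket x y)) ->
  forall x y, lspan A x -> lspan B y -> W (bracket x y).
Proof.
move=> sW h x y Ax By.
suff : [set x | W (bracket x y)] x by [].
apply: Ax; split=> [|{}x Ax].
  split=> [|a u v /= hu hv]; first by rewrite /= bracket0l; apply: subspace0.
  by rewrite bracket_linearl; apply: sW.2.
suff : [set y | W (bracket x y)] y by [].
apply: By; split=> [|{}y By]; last exact: h.
split=> [|a u v /= hu hv]; first by rewrite /= linear0; apply: subspace0.
by rewrite linearP; apply: sW.2.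
Qed.

Lemma parity_split (F : fieldType) (L : lieSuperalgebra F) p (x y : L) :
  parity_part L p x -> parity_part L (~~ p) y -> x + y = 0 -> x = 0 /\ y = 0.
Proof.
move=> px py xy.
have {}xy : x = - y by apply/eqP; rewrite -addr_eq0 xy.
have x0 : x = 0.
  have px' : parity_part L (~~ p) x by rewrite xy; apply: subspaceN => //; apply: parity_subspace.
  by case: p px px' {py} => h1 h2; [apply: parity_cap h2 h1|apply: parity_cap h1 h2].
by move: xy; rewrite x0 => /esym/eqP; rewrite oppr_eq0 => /eqP.
Qed.

(** Components are indexed below by the shifted degree, so that [C 0] is the
    component of degree -1 and all indices are natural numbers. *)
Section Grading.
Variables (F : fieldType) (L : gradedLieSuperalgebra F).
Local Notation C d := (component L (d%:Z - 1)).
Implicit Types (x y z : L) (c d : nat).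

Lemma component_subspace j : subspace (component L j).
Proof.
split=> [|a x y]; rewrite /component /=; first exact: linear0.
by move=> xj yj; rewrite linearP xj yj.
Qed.

Lemma component_proj j x : component L j (proj L j x).
Proof. by rewrite /component /= projK eqxx. Qed.

Lemma proj_inj x y : (forall j, proj L j x = proj L j y) -> x = y.
Proof.
move=> h; have [z [_ zu]] := @proj_prod _ L (fun j => proj L j x)
  (fun j => component_proj j x).
by rewrite -(zu x) // (zu y).
Qed.

Lemma proj_nat_inj x y :
  (forall d, proj L (d%:Z - 1) x = proj L (d%:Z - 1) y) -> x = y.
Proof.
move=> h; apply: proj_inj => j.
have [lt_j|] := boolP (j < -1); first by rewrite !proj_lt.
move=> ge_j; have -> : j = (absz (j + 1))%:Z - 1 by lia.
exact: h.
Qed.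

Lemma proj_component c d x : C d x -> proj L (c%:Z - 1) x = if c == d then x else 0.
Proof.
rewrite /component /= => xd; rewrite -{1}xd projK xd.
by have -> : (c%:Z - 1 == d%:Z - 1) = (c == d) by lia.
Qed.

Lemma proj_bracket_component c d m x y : C c x -> C d y ->
  proj L (m%:Z - 2) (bracket x y) = if m == (c + d)%N then bracket x y else 0.
Proof.
move=> xc yd; rewrite proj_bracket.
have E (i : 'I_m.+1) : bracket (proj L (i%:Z - 1) x) (proj L (m%:Z - i%:Z - 1) y) =
    if ((i : nat) == c) && (m == c + d)%N then bracket x y else 0.
  have -> : m%:Z - i%:Z = (m - i)%N%:Z by have := ltn_ord i; lia.
  rewrite (proj_component _ xc) (proj_component _ yd).
  case: eqVneq => [ic|_]; last by rewrite bracket0l.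
  have -> : (m - i == d)%N = (m == c + d)%N by have := ltn_ord i; lia.
  by case: eqP => _ //=; rewrite linear0.
rewrite (eq_bigr _ (fun i _ => E i)).
have [mcd|ne] := eqVneq m (c + d)%N; last by apply: big1 => i _; rewrite andbF.
have cm : (c < m.+1)%N by lia.
rewrite (bigD1 (Ordinal cm)) //= eqxx big1 ?addr0 // => i ne.
by rewrite ifN //; apply: contra ne => /andP[/eqP h _]; apply/eqP/val_inj.
Qed.

Lemma bracket_component c d x y : (0 < c + d)%N -> C c x -> C d y ->
  C (c + d).-1 (bracket x y).
Proof.
move=> cd xc yd; rewrite /component /=.
have -> : (c + d).-1%:Z - 1 = (c + d)%N%:Z - 2 by lia.
by rewrite (proj_bracket_component _ xc yd) eqxx.
Qed.

Lemma bracket_component0 x y : C 0%N x -> C 0%N y -> bracket x y = 0.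
Proof.
move=> x0 y0; apply: proj_nat_inj => d; rewrite linear0.
have -> : d%:Z - 1 = d.+1%:Z - 2 by lia.
by rewrite (proj_bracket_component _ x0 y0).
Qed.

Lemma component_parity d x : C d x -> exists u : bool -> L,
  [/\ forall p, parity_part L p (u p), forall p, C d (u p) & x = u false + u true].
Proof.
move=> xd; have [x0 p0 [x1 p1 xE]] := parity_sum x.
have [e0 e1] : proj L (d%:Z - 1) x0 - x0 = 0 /\ proj L (d%:Z - 1) x1 - x1 = 0.
  have P p y : parity_part L p y -> parity_part L p (proj L (d%:Z - 1) y - y).
    have sP : subspace (parity_part L p) by exact: parity_subspace.
    by move=> py; apply: (subspaceD sP); [exact: proj_parity|exact: subspaceN].
  apply: (parity_split (P _ _ p0) (P _ _ p1)).
  by rewrite addrACA -linearD -opprD -xE xd subrr.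
exists (fun p => if p then x1 else x0); split=> // -[] //; apply/eqP; rewrite -subr_eq0; exact/eqP.
Qed.

Lemma direct_sum_components m :
  direct_sum (fun i : 'I_m => C i) [set x | forall d, (m <= d)%N -> proj L (d%:Z - 1) x = 0].
Proof.
have projS (u : {ffun 'I_m -> L}) d : (forall i : 'I_m, C i (u i)) ->
    proj L (d%:Z - 1) (\sum_i u i) = if (insub d : option 'I_m) is Some i then u i else 0.
  move=> uC; rewrite linear_sum; case: insubP => [i _ id|]; last first.
    rewrite -leqNgt => md; apply: big1 => i _; rewrite (proj_component _ (uC i)) ifN //.
    by have := ltn_ord i; lia.
  rewrite (bigD1 i) //= big1 ?addr0 => [|j ji].
    by rewrite (proj_component _ (uC i)) -id eqxx.
  by rewrite (proj_component _ (uC j)) ifN // -id eq_sym.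
split=> [|u uC u0 i].
  apply/seteqP; split=> x /=.
    move=> xm; exists [ffun i : 'I_m => proj L (i%:Z - 1) x] => [i|].
      by rewrite ffunE; apply: component_proj.
    apply: proj_nat_inj => d; rewrite projS => [|i]; last by rewrite ffunE; apply: component_proj.
    case: insubP => [i _ <-|]; first by rewrite ffunE.
    by rewrite -leqNgt; apply: xm.
  case=> u uC -> d md; rewrite projS //; case: insubP => // i.
  by rewrite ltnNge md.
have := projS u i uC; rewrite u0 linear0 valK => ->//.
Qed.

End Grading.

(** * Iterated brackets with elements of degree -1 *)

Section HomogeneousVectors.
Variables (F : fieldType) (L : gradedLieSuperalgebra F).
Local Notation C d := (component L (d%:Z - 1)).
Implicit Types (x y z : L) (c d : nat).

(** Bundling the parity and the degree lets the sections on iterated brackets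
    apply to arbitrary families of such vectors without side conditions. *)
Record homvec := Homvec {
  hv :> L;
  hv_par : bool;
  hv_parity : parity_part L hv_par hv;
  hv_component : C 0%N hv
}.

Lemma hv_comm (b c : homvec) : bracket (b : L) (c : L) = 0.
Proof. by apply: bracket_component0; apply: hv_component. Qed.

(** Meant for f the bracket with a fixed element, on either side. *)
Lemma homvec_span (W : set L) (f : L -> L) : subspace W ->
  {morph f : x y / x + y} -> (forall b : homvec, W (f b)) -> forall b, C 0%N b -> W (f b).
Proof.
move=> sW fD h b /component_parity[u [pu cu ->]]; rewrite fD.
by apply: (subspaceD sW); [apply: (h (Homvec (pu false) (cu false))) |
                           apply: (h (Homvec (pu true) (cu true)))].
Qed.

Lemma map_hv_component (l : seq homvec) x : x \in map hv l -> C 0%N x.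
Proof.
elim: l => //= b l IH; rewrite inE => /orP[/eqP ->|]; [exact: hv_component|exact: IH].
Qed.

Lemma ad_seq_component (l : seq homvec) d x : C d x -> (size l <= d)%N ->
  C (d - size l)%N (ad_seq hv l x).
Proof.
elim: l d x => [|b l IH] d x xd /= ld; first by rewrite subn0.
have -> : (d - (size l).+1 = d.-1 - size l)%N by lia.
apply: IH; last by lia.
by have := bracket_component _ (hv_component b) xd; rewrite add0n; apply; lia.
Qed.

Lemma ad_seq_eq0 (l : seq homvec) d x : C d x -> (d < size l)%N -> ad_seq hv l x = 0.
Proof.
elim: l d x => [|b l IH] d x xd //= ld; rewrite -[LHS]/(ad_seq hv l _).
case: d xd ld => [|d] xd ld; first by rewrite bracket_component0 ?linear0 //; exact: hv_component.
by apply: (IH d) => //; apply: (bracket_component _ (hv_component b) xd).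
Qed.

Lemma ad_seq_map (X Y : Type) (e : Y -> L) (f : X -> Y) s y :
  ad_seq e (map f s) y = ad_seq (e \o f) s y.
Proof. by elim: s y => //= i s IH y; rewrite -[LHS]/(ad_seq e _ _) IH. Qed.

Lemma ad_seq_rcons (X : Type) (e : X -> L) s i y :
  ad_seq e (rcons s i) y = bracket (e i) (ad_seq e s y).
Proof. exact: foldl_rcons. Qed.

Hypothesis trans : transitive_grading L.

Lemma transitive_ad_seq k p x : C k x -> parity_part L p x ->
  (forall l : seq homvec, size l = k -> ad_seq hv l x = 0) -> x = 0.
Proof.
elim: k p x => [|k IH] p x xk px h; first exact: (h [::]).
apply: (trans (j := k%:Z)) => //; first by have -> : k%:Z = k.+1%:Z - 1 by lia.
apply: (homvec_span (W := [set 0]) (f := bracket x)) => [|y z|b /=].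
- by split=> // a y z -> ->; rewrite scaler0 addr0.
- by rewrite linearD.
apply: (bracket_eq0_skew (hv_parity b) px).
apply: (IH (hv_par b (+) p)); first exact: (bracket_component _ (hv_component b) xk).
  exact: bracket_parity (hv_parity b) px.
by move=> l lk; apply: (h (b :: l)); rewrite /= lk.
Qed.
End HomogeneousVectors.

(** * The subalgebra generated by degree -1 and the parity parts of mu *)

(** An element mu that satisfies the axioms is not assumed to be homogeneous for
    the parity.  The argument is run with its two parity parts [mup false] and
    [mup true], which inherit the commutation with degree 0. *)
Section Admissible.
Variables (F : fieldType) (charF : [pchar F] =i pred0) (L : gradedLieSuperalgebra F).
Local Notation C d := (component L (d%:Z - 1)).
Implicit Types (x y z : L) (c d : nat).
Variables (n : nat) (n_gt0 : (0 < n)%N) (mup : bool -> L).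
Hypothesis trans : transitive_grading L.
Hypothesis mup_component : forall p, C n (mup p).
Hypothesis mup_parity : forall p, parity_part L p (mup p).
Hypothesis mup_central : forall p x, C 1%N x -> bracket (mup p) x = 0.

Lemma mup_centralr p x : C 1%N x -> bracket x (mup p) = 0.
Proof.
move=> /component_parity[v [pv cv ->]].
by rewrite bracketDl !(bracket_eq0_skew (mup_parity p) (pv _)) ?mup_central ?addr0.
Qed.

(** The key vanishing.  The bracket lies in degree n - 1 + (n - 1 - size l), so
    by transitivity it vanishes as soon as all iterated brackets with
    k = 2n - 1 - size l vectors of degree -1 kill it.  Those k vectors and the
    ones of l make up a family of 2n - 1 vectors to which [ad_bracket_eq0]
    applies. *)
Lemma mup_ad_seq p q (l : seq (homvec L)) : (size l < n)%N ->
  bracket (mup p) (ad_seq (@hv _ _) l (mup q)) = 0.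
Proof.
move=> ln; set x := ad_seq _ _ _.
have xC : C (n - size l)%N x by apply: ad_seq_component => //; apply: ltnW.
pose k := (n + n.-1 - size l)%N.
have kE : (n + (n - size l)).-1 = k by rewrite /k; lia.
have gC : C k (bracket (mup p) x).
  by rewrite -kE; apply: bracket_component => //; lia.
have gP := bracket_parity (mup_parity p) (ad_seq_parity (@hv_parity _ L) l (mup_parity q)).
apply: (transitive_ad_seq trans gC gP) => l' l'k.
pose t := size l; pose e (i : 'I_k + 'I_t) : homvec L :=
  match i with inl j => tnth (tcast l'k (in_tuple l')) j | inr j => tnth (in_tuple l) j end.
pose r : seq ('I_k + 'I_t) := map inl (enum 'I_k) ++ map inr (enum 'I_t).
pose K : {set 'I_k + 'I_t} := [set i : 'I_k + 'I_t | if i is inl _ then true else false]%SET.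
have r_uniq : uniq r.
  rewrite cat_uniq; apply/and3P; split.
  - by rewrite map_inj_uniq ?enum_uniq // => i j [].
  - by apply/hasPn => _ /mapP[j _ ->]; apply/mapP => -[].
  - by rewrite map_inj_uniq ?enum_uniq // => i j [].
have r_full i : i \in r.
  by rewrite mem_cat; case: i => i; rewrite map_f ?mem_enum ?orbT.
have cardX : #|{: 'I_k + 'I_t}| = (n + n.-1)%N.
  by rewrite card_sum !card_ord /k /t; lia.
have rl : [seq i <- r | i \in K] = map inl (enum 'I_k).
  rewrite filter_cat (all_filterP _) ?(eq_in_filter (a2 := pred0)) ?filter_pred0 ?cats0 //.
    by move=> _ /mapP[j _ ->]; rewrite inE.
  by apply/allP => _ /mapP[j _ ->]; rewrite inE.
have rr : [seq i <- r | i \notin K] = map inr (enum 'I_t).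
  rewrite filter_cat (eq_in_filter (a2 := pred0)) ?filter_pred0 ?(all_filterP _) //.
    by apply/allP => _ /mapP[j _ ->]; rewrite inE.
  by move=> _ /mapP[j _ ->]; rewrite inE.
have El y : ad_seq (@hv _ L \o e) (map inl (enum 'I_k)) y = ad_seq (@hv _ _) l' y.
  rewrite ad_seq_map -(ad_seq_map _ (e \o inl)).
  by have -> : map (e \o inl) (enum 'I_k) = l' by rewrite map_tnth_enum val_tcast.
have Er y : ad_seq (@hv _ L \o e) (map inr (enum 'I_t)) y = ad_seq (@hv _ _) l y.
  rewrite ad_seq_map -(ad_seq_map _ (e \o inr)).
  by have -> : map (e \o inr) (enum 'I_t) = l by rewrite map_tnth_enum.
have vanish p' (s : seq ('I_k + 'I_t)) : (n < size s)%N -> ad_seq (@hv _ L \o e) s (mup p') = 0.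
  by move=> ns; rewrite -ad_seq_map (ad_seq_eq0 (mup_component p')) ?size_map.
have deg0 p' (s : seq ('I_k + 'I_t)) : size s = n.-1 -> C 1%N (ad_seq (@hv _ L \o e) s (mup p')).
  move=> sn; rewrite -ad_seq_map; have -> : 1%N = (n - size (map e s))%N by rewrite size_map; lia.
  by apply: ad_seq_component => //; rewrite size_map; lia.
have := @ad_bracket_eq0 _ charF L _ (@hv _ L \o e) (@hv_par _ L \o e)
  (fun i => hv_parity (e i)) (fun i j => hv_comm (e i) (e j)) r n p (mup p) (mup q)
  r_uniq r_full cardX n_gt0 (mup_parity p) (vanish p) (vanish q)
  (fun s sn => mup_central p (deg0 q s sn)) (fun s sn => mup_centralr q (deg0 p s sn)) K.
rewrite rl rr El Er; apply.
rewrite -(size_filter_card r_uniq r_full) rl size_map size_enum_ord /k; lia.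
Qed.

Definition monomial t : set L :=
  [set x | exists2 l : seq (homvec L), size l = t & exists p, x = ad_seq (@hv _ L) l (mup p)].

Definition mspan t : set L := lspan (monomial t).

Lemma mspan_subspace t : subspace (mspan t).
Proof. exact: lspan_subspace. Qed.

(** A bracket of elements of [mspan t] and [mspan s] has degree
    2 (n - 1) - t - s.  This is the degree of [mspan (t + s - (n - 1))], and in
    degrees n - 1 and above the bracket vanishes. *)
Definition mrange r : set L := if (r < n)%N then [set 0] else mspan (r.+1 - n).

Lemma mrange_subspace r : subspace (mrange r).
Proof.
rewrite /mrange; case: ifP => _; last exact: lspan_subspace.
by split=> // a x y -> ->; rewrite scaler0 addr0.
Qed.

Lemma monomial_parity t x : monomial t x -> exists p, parity_part L p x.
Proof.
case=> l _ [p ->]; exists (par_seq (@hv_par _ L) l (+) p).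
exact: (ad_seq_parity (@hv_parity _ L)).
Qed.

Lemma bracket_hv_mspan (b : homvec L) t x : mspan t x -> mspan t.+1 (bracket (b : L) x).
Proof.
move: (lspan_incl (erefl (b : L) : [set (b : L)] b)); apply: bracket_lspan; first exact: lspan_subspace.
move=> _ y -> [l lt [p ->]]; apply: lspan_incl; exists (rcons l b).
  by rewrite size_rcons lt.
by exists p; rewrite ad_seq_rcons.
Qed.

Lemma bracketl_mspan b t x : C 0%N b -> mspan t x -> mspan t.+1 (bracket b x).
Proof.
move=> b0 xt; apply: (homvec_span (f := fun b => bracket b x)) b0 => [|y z|c].
- exact: lspan_subspace.
- exact: bracketDl.
- exact: bracket_hv_mspan.
Qed.

Lemma bracketr_mspan b t x : C 0%N b -> mspan t x -> mspan t.+1 (bracket x b).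
Proof.
move=> b0 xt; apply: (homvec_span (f := bracket x)) b0 => [|y z|c].
- exact: lspan_subspace.
- by rewrite linearD.
have c_span : lspan [set (c : L)] (c : L) by apply: lspan_incl.
move: xt c_span; apply: bracket_lspan.
  exact: lspan_subspace.
move=> y _ yt ->; have [p py] := monomial_parity yt.
rewrite (bracket_skew py (hv_parity c)); apply: (subspaceN (mspan_subspace _)).
apply: (subspaceZ (mspan_subspace _)).
by apply: bracket_hv_mspan; apply: lspan_incl.
Qed.

Lemma bracket_hv_mrange (b : homvec L) r x : mrange r x -> mrange r.+1 (bracket (b : L) x).
Proof.
rewrite {1}/mrange; case: ltnP => rn.
  by move=> ->; rewrite linear0; apply: (subspace0 (mrange_subspace _)).
by rewrite /mrange ltnNge (leqW rn) /= => /(bracket_hv_mspan b); rewrite -subSn // leqW.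
Qed.

(** Induction on the number of vectors in the second monomial, moving its
    outermost vector b across with the Jacobi identity.  The new term is
    [x, b] paired with a shorter monomial: either [x, b] is, up to sign, a monomial
    of nonnegative degree, or x has degree 0 and [x, b] is a vector of
    degree -1. *)
Lemma bracket_monomials t s x y : (t < n)%N -> monomial t x -> monomial s y ->
  mrange (t + s) (bracket x y).
Proof.
move=> + + [l <- [p ->{y}]]; elim/last_ind: l t x => [|l b IH] t x tn xt.
  have [q px] := monomial_parity xt.
  rewrite addn0 /mrange tn /=; case: xt px => l lt [q' ->] px.
  by apply: bracket_eq0_skew (mup_parity p) px _; apply: mup_ad_seq; rewrite lt.
have [q px] := monomial_parity xt.
rewrite size_rcons ad_seq_rcons (bracket_jacobi _ px (hv_parity b)) addnS.
apply: (subspaceD (mrange_subspace _)); last first.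
  by apply: (subspaceZ (mrange_subspace _)); apply: bracket_hv_mrange; apply: IH.
rewrite (bracket_skew px (hv_parity b)) -scaleNr bracketZl.
apply: (subspaceZ (mrange_subspace _)).
case: xt px => l' lt [q' ->] px; rewrite -[bracket (b : L) _]ad_seq_rcons -addSn.
have [tn'|tn'] := ltnP t.+1 n.
  by apply: IH => //; exists (rcons l' b); [rewrite size_rcons lt | exists q'].
rewrite /mrange ltnNge (leq_trans tn') ?leq_addr //=.
have -> : ((t.+1 + size l).+1 - n = (size l).+1)%N by lia.
apply: bracketl_mspan; last by apply: lspan_incl; exists l => //; exists p.
have -> : 0%N = (n - size (rcons l' b))%N by rewrite size_rcons; lia.
by apply: ad_seq_component; rewrite ?size_rcons //; lia.
Qed.

Lemma bracket_mspan t s x y : (t < n)%N -> mspan t x -> mspan s y -> mrange (t + s) (bracket x y).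
Proof.
move=> tn; apply: bracket_lspan; first exact: mrange_subspace.
by move=> {}x {}y; apply: bracket_monomials.
Qed.

Lemma mspan_component t x : (t <= n)%N -> mspan t x -> C (n - t)%N x.
Proof.
move=> tn; apply: lspan_min; first exact: component_subspace.
by move=> _ [l lt [p ->]]; rewrite -lt; apply: ad_seq_component; rewrite ?lt.
Qed.

Definition mu_sum := mup false + mup true.

(** The graded pieces of the subalgebra generated by degree -1 and mu, in
    shifted degrees.  In top degree only multiples of mu itself occur, since no
    bracket reaches that degree. *)
Definition piece d : set L :=
  if d == 0%N then C 0%N else if (d < n)%N then mspan (n - d) else
  if d == n then [set a *: mu_sum | a in [set: F]] else [set 0].

Lemma piece_subspace d : subspace (piece d).
Proof.
rewrite /piece; case: eqP => _; first exact: component_subspace.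
case: ifP => _; first exact: lspan_subspace.
case: eqP => _.
  split=> [|a x y]; first by exists 0 => //; rewrite scale0r.
  by move=> [b _ <-] [c _ <-]; exists (a * b + c) => //; rewrite scalerDl scalerA.
by split=> // a x y -> ->; rewrite scaler0 addr0.
Qed.

Lemma mu_mspan : mspan 0%N mu_sum.
Proof.
have h p : mspan 0%N (mup p) by apply: lspan_incl; exists [::] => //; exists p.
by apply: (subspaceD (mspan_subspace _)).
Qed.

Lemma piece_mspan d x : (0 < d <= n)%N -> piece d x -> mspan (n - d) x.
Proof.
case/andP=> d0 dn; rewrite /piece gtn_eqF //; case: ltnP => // nd.
have -> : d = n by lia.
rewrite eqxx => -[a _ <-]; rewrite subnn; apply: (subspaceZ (mspan_subspace _)).
exact: mu_mspan.
Qed.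

Lemma mspan_piece d x : (0 < d < n)%N -> mspan (n - d) x -> piece d x.
Proof. by case/andP=> d0 dn; rewrite /piece gtn_eqF // dn. Qed.

Lemma piece_gt d x : (n < d)%N -> piece d x -> x = 0.
Proof. by move=> nd; rewrite /piece gtn_eqF ?(leq_trans _ nd) // ltnNge ltnW //= gtn_eqF. Qed.

Lemma piece_component d x : piece d x -> C d x.
Proof.
case: (posnP d) => [->|d0]; first by rewrite /piece.
have [dn|nd] := leqP d n; last first.
  by move/(piece_gt nd) => ->; apply: (subspace0 (component_subspace _ _)).
move/piece_mspan; rewrite d0 dn => /(_ isT)/mspan_component; rewrite subKn //.
by apply; apply: leq_subr.
Qed.

Lemma bracket_piece c d x y : (0 < c + d)%N -> piece c x -> piece d y ->
  piece (c + d).-1 (bracket x y).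
Proof.
move=> cd xG yG; have [xC yC] := (piece_component xG, piece_component yG).
have [cn|nc] := leqP c n; last first.
  by rewrite (piece_gt nc xG) bracket0l; apply: (subspace0 (piece_subspace _)).
have [dn|nd] := leqP d n; last first.
  by rewrite (piece_gt nd yG) linear0; apply: (subspace0 (piece_subspace _)).
have [c0|c_gt0] := posnP c.
  rewrite c0 add0n in cd *.
  have [d1|d_gt1] := leqP d 1.
    have := bracket_component _ xC yC; rewrite c0 add0n => /(_ cd).
    by have -> : d.-1 = 0%N by lia.
  apply: mspan_piece; first by lia.
  have -> : (n - d.-1 = (n - d).+1)%N by lia.
  apply: bracketl_mspan; first by rewrite -c0.
  by apply: piece_mspan => //; rewrite cd.
have [d0|d_gt0] := posnP d.
  rewrite d0 addn0 in cd *.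
  have [c1|c_gt1] := leqP c 1.
    have := bracket_component _ xC yC; rewrite d0 addn0 => /(_ cd).
    by have -> : c.-1 = 0%N by lia.
  apply: mspan_piece; first by lia.
  have -> : (n - c.-1 = (n - c).+1)%N by lia.
  apply: bracketr_mspan; first by rewrite -d0.
  by apply: piece_mspan => //; rewrite cd.
have h : mrange ((n - c) + (n - d)) (bracket x y).
  apply: bracket_mspan; first by lia.
    by apply: piece_mspan => //; rewrite c_gt0.
  by apply: piece_mspan => //; rewrite d_gt0.
move: h; rewrite /mrange; case: ltnP => [_ ->|le h]; first by apply: (subspace0 (piece_subspace _)).
apply: mspan_piece; first by lia.
by move: h; congr (mspan _ _); lia.
Qed.

(** The case c + d = n + 1, where the bracket has the degree of mu, is what
    makes the lower components an ideal. *)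
Lemma bracket_piece_top c d x y : (0 < c)%N -> (0 < d)%N -> (n < c + d)%N ->
  piece c x -> piece d y -> bracket x y = 0.
Proof.
move=> c0 d0 cd xG yG.
have [cn|nc] := leqP c n; last by rewrite (piece_gt nc xG) bracket0l.
have [dn|nd] := leqP d n; last by rewrite (piece_gt nd yG) linear0.
have : mrange ((n - c) + (n - d)) (bracket x y).
  apply: bracket_mspan; first by lia.
    by apply: piece_mspan => //; rewrite c0.
  by apply: piece_mspan => //; rewrite d0.
by rewrite /mrange ifT //; lia.
Qed.

Hypothesis gen : generated (component L (-1) `|` [set mu_sum]) = setT.

Lemma proj_piece d x : piece d (proj L (d%:Z - 1) x).
Proof.
move: d; suff : [set x | forall d, piece d (proj L (d%:Z - 1) x)] x by [].
have : generated (component L (-1) `|` [set mu_sum]) x by rewrite gen.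
have muC : C n mu_sum by apply: (subspaceD (component_subspace _ _)).
apply; split=> [|{}x [x1|->] d]; last 2 first.
- rewrite (proj_component _ (x1 : C 0%N x)); case: eqP => [->|_]; first by rewrite /piece.
  by apply: (subspace0 (piece_subspace _)).
- rewrite (proj_component _ muC); case: eqP => [->|_]; last first.
    by apply: (subspace0 (piece_subspace _)).
  by rewrite /piece gtn_eqF // ltnn eqxx; exists 1 => //; rewrite scale1r.
split=> [|{}x y xG yG d /=].
  split=> [d|a {}x y xG yG d /=]; first by rewrite linear0; apply: (subspace0 (piece_subspace _)).
  by rewrite linearP; apply: (piece_subspace d).2.
have -> : d%:Z - 1 = d.+1%:Z - 2 by lia.
rewrite proj_bracket; apply: (subspace_sum (piece_subspace _)) => i _.
have -> : d.+1%:Z - i%:Z = (d.+1 - i)%N%:Z by have := ltn_ord i; lia.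
have i_le := ltn_ord i; rewrite [in piece _](_ : d = (i + (d.+1 - i)).-1); last by lia.
by apply: bracket_piece => //; lia.
Qed.

Lemma component_piece d x : C d x -> piece d x.
Proof. by move=> xd; rewrite -(xd : proj L _ x = x); apply: proj_piece. Qed.

(** The span of mu is a graded component, hence stable under taking parity
    parts, so one of the parity parts of mu is zero. *)
Lemma mup_homogeneous : exists p, mup (~~ p) = 0.
Proof.
have : piece n (mup false) by apply: component_piece; apply: mup_component.
rewrite /piece gtn_eqF // ltnn eqxx => -[a _ aE].
have [h0 h1] : (a - 1) *: mup false = 0 /\ a *: mup true = 0.
  apply: (@parity_split _ _ false).
  - by apply: subspaceZ; [apply: parity_subspace | apply: (mup_parity false)].
  - by apply: subspaceZ; [apply: parity_subspace | apply: (mup_parity true)].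
  by rewrite scalerBl scale1r addrAC -scalerDr -[a *: _]/(a *: mu_sum) aE subrr.
move/eqP: h1; rewrite scaler_eq0 => /orP[/eqP a0|/eqP u1]; last by exists false.
by exists true; rewrite -aE a0 scale0r.
Qed.

Lemma mspan_ad_pow t : mspan t = ad_pow t mu_sum.
Proof.
have [p up] := mup_homogeneous; have muE : mu_sum = mup p.
  by move: up; rewrite /mu_sum; case: p => /= ->; rewrite ?add0r ?addr0.
apply/seteqP; split=> x; last first.
  apply: lspan_min; first exact: mspan_subspace.
  move=> _ [a /= ha <-].
  suff : mspan (size (val a)) (foldr bracket mu_sum (val a)) by rewrite size_tuple.
  have : forall b, b \in val a -> C 0%N b.
    by move=> b /tnthP[i ->]; apply: ha.
  elim: (val a) => [|b l IH] hl /=; first exact: mu_mspan.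
  apply: bracketl_mspan; first by apply: hl; rewrite mem_head.
  by apply: IH => c cl; apply: hl; rewrite inE cl orbT.
apply: lspan_min; first exact: lspan_subspace.
move=> _ [l lt [q ->]]; have [->|qp] := eqVneq q p; last first.
  have -> : q = ~~ p by move: qp; case: p {up muE}; case: q.
  by rewrite up linear0; apply: subspace0; apply: lspan_subspace.
apply: lspan_incl.
have st : size (rev (map (@hv _ L) l)) == t by rewrite size_rev size_map lt.
exists (Tuple st) => /=.
  move=> i; have : tnth (Tuple st) i \in rev (map (@hv _ L) l) by apply: mem_tnth.
  rewrite mem_rev; exact: map_hv_component.
by rewrite -foldl_rev revK muE -[RHS](ad_seq_map id).
Qed.

End Admissible.

(** * The structure of admissible pairs *)

Theorem theorem0p2 (F : fieldType) (charF : [pchar F] =i pred0)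
    (n : nat) (n_ge2 : (2 <= n)%N)
    (L : gradedLieSuperalgebra F) (mu : L) (adm : admissible n mu) :
  [/\ direct_sum (fun i : 'I_n.+1 => component L (i%:Z - 1)) setT,
      component L (n%:Z - 1) = [set a *: mu | a in [set: F]],
      exists2 S : set L,
        direct_sum (fun i : 'I_n => component L (i%:Z - 1)) S & ideal S
    & forall j : nat, (j < n)%N -> component L j%:Z = ad_pow (n - j - 1) mu].
Proof.
case: adm => muC trans gen central.
have n_gt0 : (0 < n)%N by apply: leq_trans n_ge2.
have [mup [mup_par mup_comp muE]] := component_parity muC.
have mup_central p x : component L (1%N%:Z - 1) x -> bracket (mup p) x = 0.
  move=> /component_parity[v [pv cv ->]]; rewrite linearD /=.
  suff h q : bracket (mup p) (v q) = 0 by rewrite !h addr0.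
  have : bracket (mup false) (v q) + bracket (mup true) (v q) = 0.
    by rewrite -bracketDl -muE; apply: central; apply: (cv q).
  have par1 : parity_part L (~~ q) (bracket (mup true) (v q)).
    exact: bracket_parity (mup_par true) (pv q).
  move=> /(parity_split (bracket_parity (mup_par false) (pv q)) par1)[h0 h1].
  by case: p.
rewrite muE in gen *.
have projG := proj_piece charF n_gt0 trans mup_comp mup_par mup_central gen.
have compG := component_piece charF n_gt0 trans mup_comp mup_par mup_central gen.
have top : piece n mup n = [set a *: (mup false + mup true) | a in [set: F]].
  by rewrite /piece gtn_eqF // ltnn eqxx.
split.
- have := direct_sum_components L n.+1; congr (direct_sum _ _).
  apply/seteqP; split=> // x _ d nd; exact: piece_gt nd (projG d x).
- rewrite -top; apply/seteqP; split=> x; first exact: compG.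
  exact: piece_component.
- exists [set x | forall d, (n <= d)%N -> proj L (d%:Z - 1) x = 0].
    exact: direct_sum_components.
  (* The outermost terms of the bracket formula involve a component above mu. *)
  have brS x y d : (n <= d)%N -> proj L (d%:Z - 1) (bracket x y) = 0.
    have [->|ne nd] := eqVneq d n; last by apply: (piece_gt _ (projG _ _)); lia.
    have -> : n%:Z - 1 = n.+1%:Z - 2 by lia.
    rewrite proj_bracket big1 // => i _; have i_le := ltn_ord i.
    have -> : n.+1%:Z - i%:Z = (n.+1 - i)%N%:Z by lia.
    have [i0|i_gt0] := posnP i; first by rewrite (piece_gt _ (projG _ y)) ?linear0 //; lia.
    have [in1|i_lt] := leqP n.+1 i; first by rewrite (piece_gt _ (projG _ x)) ?bracket0l.
    apply: (bracket_piece_top charF n_gt0 trans mup_comp mup_par mup_central (c := i))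
      (projG _ _) (projG _ _); lia.
  split.
  + split=> [d _|a x y xS yS d nd]; first by rewrite linear0.
    by rewrite linearP /= xS ?yS ?scaler0 ?addr0.
  + move=> x0 x1 p0 p1 S01.
    have h d : (n <= d)%N -> proj L (d%:Z - 1) x0 = 0 /\ proj L (d%:Z - 1) x1 = 0.
      move=> nd; have := S01 d nd; rewrite linearD.
      exact: (@parity_split _ _ false) (proj_parity _ p0) (proj_parity _ p1).
    by split=> d /h[].
  + by move=> x y _; split=> d; apply: brS.
move=> j jn.
have -> : component L j%:Z = component L (j.+1%:Z - 1) by congr component; lia.
rewrite -(mspan_ad_pow charF n_gt0 trans mup_comp mup_par mup_central gen) -subnDA addn1.
apply/seteqP; split=> x.
  by move=> /compG; apply: piece_mspan => //; rewrite jn.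
have {2}-> : j.+1 = (n - (n - j.+1))%N by rewrite subKn.
by apply: mspan_component => //; apply: leq_subr.
Qed.
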